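(* Let $T:V\to A$ be a relative Rota-Baxter operator on a Jacobi-Jordan algebra $(A,\ast)$ with respect to a representation $(V,\rho)$. Then for any Nijenhuis element $x\in N_{ij}(T)$ associated to $T$, the family $T_t=T+tJ$ with $J=-\partial_{\rho_T}(x)$, i.e. $$J(v)=T(\rho(x)v)-T(v)\ast x,\quad v\in V,$$ is a trivial linear deformation of the relative Rota-Baxter operator $T$.
   Context: All vector spaces are finite dimensional over a field $\mathbb{K}$ of characteristic $0$; an algebra is a vector space with a bilinear product, not assumed associative. A Jacobi-Jordan algebra is an algebra $(A,\ast)$ with $x\ast y=y\ast x$ and $(x\ast y)\ast z+(y\ast z)\ast x+(z\ast x)\ast y=0$ for all $x,y,z$. A representation of $(A,\ast)$ is a pair $(V,\rho)$ with $\rho:A\to gl(V)$ linear such that $\rho(x\ast y)=-\rho(x)\rho(y)-\rho(y)\rho(x)$. A linear map $T:V\to A$ is a relative Rota-Baxter operator with respect to $(V,\rho)$ if $T(u)\ast T(v)=T(\rho(T(u))v+\rho(T(v))u)$ for all $u,v\in V$. A linear deformation of $T$ is a family $T_t=T+tJ$ with $J:V\to A$ linear such that $T_t$ is a relative Rota-Baxter operator with respect to $(V,\rho)$ for all $t\in\mathbb{K}$. A morphism from a relative Rota-Baxter operator $T'$ to a relative Rota-Baxter operator $T$ (both with respect to $(V,\rho)$) is a pair $(\phi_A,\phi_V)$ with $\phi_A:A\to A$ a Jacobi-Jordan algebra morphism and $\phi_V:V\to V$ linear such that $T\circ\phi_V=\phi_A\circ T'$ and $\phi_V\circ\rho(y)=\rho(\phi_A(y))\circ\phi_V$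 for all $y\in A$. Write $L_x(y)=x\ast y$. A linear deformation $T_t=T+tJ$ is trivial if there exists $x\in C^0(V,A)=A$ such that, for all $t\in\mathbb{K}$, $(Id_A+tL_x,Id_V+t\rho(x))$ is a morphism from $T_t$ to $T$. The map $\partial_{\rho_T}$ is the degree-zero differential $\partial_{\rho_T}(x)(v)=T(v)\ast x-T(\rho(x)v)$. An element $x\in A$ is a Nijenhuis element associated to $T$ if for all $y,z\in A$: $$(x\ast y)\ast(x\ast z)=0,\qquad (x\ast y)\ast z+(z\ast x)\ast y-(y\ast z)\ast x=0,$$ $$\rho(x\ast y)\circ\rho(x)=0,\qquad \rho(x\ast y)+\rho(y)\circ\rho(x)-\rho(x)\circ\rho(y)=0,$$ $$L_x\circ T\circ\rho(x)-L_x\circ L_x\circ T=0.$$ $N_{ij}(T)$ denotes the set of all Nijenhuis elements associated to $T$. *)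

(* Defs.v *)
From HB Require Import structures.
From mathcomp Require Import all_boot all_order all_algebra.

Set Implicit Arguments.
Unset Strict Implicit.
Unset Printing Implicit Defensive.

Import GRing.Theory.
Local Open Scope ring_scope.

Section JacobiJordan.

Variables (K : fieldType) (A : vectType K) (mul : {bilinear A -> A -> A}).

Definition jacobi_jordan_algebra : Prop :=
  (forall x y, mul x y = mul y x) /\
  (forall x y z, mul (mul x y) z + mul (mul y z) x + mul (mul z x) y = 0).

Definition algebra_morphism (phi : 'End(A)) : Prop :=
  forall x y, phi (mul x y) = mul (phi x) (phi y).

Definition lmul (x : A) : 'End(A) := linfun (mul x).
Definition rmul (x : A) : 'End(A) := linfun (applyr mul x).

Lemma lmulE x y : lmul x y = mul x y.
Proof. by rewrite lfunE. Qed.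

Lemma rmulE x y : rmul x y = mul y x.
Proof. by rewrite lfunE. Qed.

Variable V : vectType K.

Definition representation (rho : 'Hom(A, 'End(V))) : Prop :=
  forall x y,
    rho (mul x y) = (- (rho x \o rho y)%VF) - (rho y \o rho x)%VF.

Variable rho : 'Hom(A, 'End(V)).

Definition relative_rota_baxter (T : 'Hom(V, A)) : Prop :=
  forall u v, mul (T u) (T v) = T (rho (T u) v + rho (T v) u).

(* (phiA, phiV) is a morphism from T' to T; that T' and T are relative
   Rota-Baxter operators is not part of this predicate. *)
Definition rota_baxter_morphism (T' T : 'Hom(V, A))
    (phiA : 'End(A)) (phiV : 'End(V)) : Prop :=
  [/\ algebra_morphism phiA,
      (T \o phiV = phiA \o T')%VF
    & forall y, (phiV \o rho y = rho (phiA y) \o phiV)%VF].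

(* The family T_t = T + t J is represented by its direction J. *)
Definition linear_deformation (T J : 'Hom(V, A)) : Prop :=
  forall t : K, relative_rota_baxter (T + t *: J).

Definition trivial_linear_deformation (T J : 'Hom(V, A)) : Prop :=
  linear_deformation T J /\
  exists x : A, forall t : K,
    rota_baxter_morphism (T + t *: J) T
      (\1%VF + t *: lmul x) (\1%VF + t *: rho x).

Definition rota_baxter_diff (T : 'Hom(V, A)) (x : A) : 'Hom(V, A) :=
  ((rmul x \o T) - (T \o rho x))%VF.

Lemma rota_baxter_diffE T x v :
  rota_baxter_diff T x v = mul (T v) x - T (rho x v).
Proof. by rewrite /rota_baxter_diff add_lfunE opp_lfunE !comp_lfunE rmulE. Qed.

Lemma opp_rota_baxter_diffE T x v :
  (- rota_baxter_diff T x) v = T (rho x v) - mul (T v) x.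
Proof. by rewrite opp_lfunE rota_baxter_diffE opprB. Qed.

Definition nijenhuis_element (T : 'Hom(V, A)) (x : A) : Prop :=
  (forall y z : A,
    [/\ mul (mul x y) (mul x z) = 0,
        mul (mul x y) z + mul (mul z x) y - mul (mul y z) x = 0,
        (rho (mul x y) \o rho x)%VF = 0
      & (rho (mul x y) + (rho y \o rho x) - (rho x \o rho y))%VF = 0]) /\
  ((lmul x \o T \o rho x) - (lmul x \o lmul x \o T))%VF = 0.

End JacobiJordan.

(* Main.v *)
(** For the morphism pair [phiA = Id + t L_x], [phiV = Id + t rho(x)], the first
    four Nijenhuis conditions say that [phiA] is an algebra morphism and that
    [phiV] intertwines [rho(y)] and [rho(phiA y)]; the last one says that
    [T phiV = phiA T_t].  Transporting the Rota-Baxter identity of [T] along the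
    pair gives [phiA (D t) = 0], where [D t] is the defect of the Rota-Baxter
    identity for [T_t].  Since [D t = t D1 + t^2 D2] and
    [phiA = Id + t L_x] is the identity modulo [t], comparing the coefficients
    of [t] and [t^2] forces [D1 = D2 = 0]. *)
Require Import Defs.
From mathcomp Require Import all_boot all_order all_algebra.
From mathcomp Require Import ring.
Import GRing.Theory VectorInternalTheory.
Local Open Scope ring_scope.

(** The values at [t = 1, -1, 2] suffice once 2 and 6 are invertible, which is where characteristic
    0 enters. *)
Lemma vect_cubic_eq0 (K : fieldType) (A : vectType K) (a b c : A) :
    [pchar K] =i pred0 ->
    (forall t : K, t *: a + t ^+ 2 *: b + t ^+ 3 *: c = 0) ->
  a = 0 /\ b = 0.
Proof.
move=> charK0 abc0.
have nz n : (n.+1)%:R != 0 :> K by rewrite ((pcharf0P K).1 charK0).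
have b0 : b = 0.
  apply: (scalerI (nz 1)); rewrite scaler0.
  (* Adding the values at 1 and -1 cancels the odd terms and leaves [2 b]. In coordinates this is a
     scalar identity for [ring]. *)
  transitivity ((1 *: a + 1 ^+ 2 *: b + 1 ^+ 3 *: c)
              + ((-1) *: a + (-1) ^+ 2 *: b + (-1) ^+ 3 *: c)).
    by apply: v2r_inj; rewrite !linearD !linearZ; apply/rowP => i;
       rewrite !mxE; ring.
  by rewrite !abc0 addr0.
split=> //; apply: (scalerI (nz 5)); rewrite scaler0.
(* The factor 8 = 2^3 cancels [c]; with [b = 0], what remains is [(8 - 2) a]. *)
transitivity (8%:R *: (1 *: a + 1 ^+ 2 *: b + 1 ^+ 3 *: c)
            - (2%:R *: a + 2%:R ^+ 2 *: b + 2%:R ^+ 3 *: c)).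
  by rewrite b0; apply: v2r_inj;
     rewrite !(linearD, linearN, linearZ, linear0); apply/rowP => i;
     rewrite !mxE; ring.
by rewrite !abc0 scaler0 subr0.
Qed.

Section NijenhuisDeformation.
Set Implicit Arguments.
Unset Strict Implicit.

Variables (K : fieldType) (A V : vectType K) (mul : {bilinear A -> A -> A}).
Variables (rho : 'Hom(A, 'End(V))).
Implicit Types (T J : 'Hom(V, A)) (x : A) (t : K) (u v : V).

Lemma id_add_scaleE (U : vectType K) t (f : 'End(U)) y :
  (\1%VF + t *: f) y = y + t *: f y.
Proof. by rewrite add_lfunE id_lfunE scale_lfunE. Qed.

Definition rota_baxter_arg T u v : V := rho (T u) v + rho (T v) u.

Definition rota_baxter_defect T u v : A :=
  mul (T u) (T v) - T (rota_baxter_arg T u v).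

(** The defect is quadratic in the operator, so the coefficient of [t] is its polarization at [T]
    and [J]. *)
Lemma rota_baxter_defectDZ T J t u v :
  rota_baxter_defect (T + t *: J) u v =
    rota_baxter_defect T u v
    + t *: (mul (T u) (J v) + mul (J u) (T v)
            - T (rota_baxter_arg J u v) - J (rota_baxter_arg T u v))
    + t ^+ 2 *: rota_baxter_defect J u v.
Proof.
have argDZ : rota_baxter_arg (T + t *: J) u v =
             rota_baxter_arg T u v + t *: rota_baxter_arg J u v.
  rewrite /rota_baxter_arg !add_lfunE !scale_lfunE !linearD !linearZ /=.
  by rewrite !add_lfunE !scale_lfunE addrACA.
rewrite /rota_baxter_defect argDZ !add_lfunE !scale_lfunE.
rewrite !(linearDl, linearDr, linearD, linearZl_LR, linearZr_LR, linearZ) /=.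
by apply: v2r_inj; rewrite !(linearD, linearN, linearZ) /=;
   apply/rowP => i; rewrite !mxE; ring.
Qed.

Lemma relative_rota_baxter_defectP T :
  relative_rota_baxter mul rho T <-> (forall u v, rota_baxter_defect T u v = 0).
Proof.
split=> TP u v; first by apply/eqP; rewrite subr_eq0; apply/eqP/TP.
by apply/eqP; rewrite -subr_eq0; apply/eqP/TP.
Qed.

(** Neither operator is assumed Rota-Baxter, so this applies to the family before it is known to be
    a deformation. *)
Lemma rota_baxter_morphism_defect T' T phiA phiV u v :
    rota_baxter_morphism mul rho T' T phiA phiV ->
  phiA (rota_baxter_defect T' u v) = rota_baxter_defect T (phiV u) (phiV v).
Proof.
case=> phiM /lfunP TphiE /(_ _)/lfunP phi_rhoE.
have phiTE w : T (phiV w) = phiA (T' w) by have := TphiE w; rewrite !comp_lfunE.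
have phirE y w : phiV (rho y w) = rho (phiA y) (phiV w).
  by have := phi_rhoE y w; rewrite !comp_lfunE.
rewrite /rota_baxter_defect /rota_baxter_arg linearB /= phiM -!phiTE.
by rewrite [phiV (_ + _)]linearD /= !phirE -!phiTE.
Qed.

Lemma nijenhuis_morphism T x t :
    jacobi_jordan_algebra mul -> nijenhuis_element mul rho T x ->
  rota_baxter_morphism mul rho (T + t *: - rota_baxter_diff mul rho T x) T
    (\1%VF + t *: lmul mul x) (\1%VF + t *: rho x).
Proof.
case=> mulC _ [Nx NTx]; split.
- move=> y z; rewrite !id_add_scaleE !lmulE.
  have [mul0 mulE _ _] := Nx y z.
  (* Up to commutativity, the second Nijenhuis identity says that [L_x] is a derivation: the
     [t]-coefficient of multiplicativity. [mul0] is the [t^2]-coefficient. *)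
  have {mulE}-> : mul x (mul y z) = mul (mul x y) z + mul y (mul x z).
    rewrite (mulC x (mul y z)) (mulC y (mul x z)) (mulC x z).
    by apply/esym/eqP; rewrite -subr_eq0 mulE.
  rewrite !(linearDl, linearDr, linearZl_LR, linearZr_LR) /= mul0 !scaler0 addr0.
  by rewrite scalerDr -addrA; congr (_ + _); rewrite addrC.
- apply/lfunP => v; rewrite !comp_lfunE !id_add_scaleE lmulE.
  rewrite add_lfunE scale_lfunE opp_rota_baxter_diffE linearD linearZ /=.
  rewrite (mulC (T v)) linearDr linearZr_LR linearBr /=.
  (* The choice of [J] settles order [t]; the last Nijenhuis condition kills the [t^2] term. *)
  have /lfunP/(_ v) := NTx.
  rewrite add_lfunE opp_lfunE !comp_lfunE !lmulE zero_lfunE => ->.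
  by rewrite scaler0 addr0 scalerBr -addrA subrK.
(* The conditions on [rho] do not involve [z]; 0 is a filler. *)
- move=> y; have [_ _ rho0 rhoE] := Nx y 0.
  apply/lfunP => v; rewrite !comp_lfunE !id_add_scaleE lmulE.
  rewrite [rho (_ + _)]linearD /= [rho (_ *: _)]linearZ /= add_lfunE scale_lfunE.
  rewrite !linearD !linearZ /=.
  have /lfunP/(_ v) := rho0; rewrite comp_lfunE zero_lfunE => ->.
  have /lfunP/(_ v) := rhoE.
  rewrite !add_lfunE opp_lfunE !comp_lfunE zero_lfunE => /eqP.
  rewrite subr_eq0 => /eqP <-.
  by rewrite !scaler0 addr0 scalerDr -addrA; congr (_ + _); rewrite addrC.
Qed.

End NijenhuisDeformation.

Theorem theorem3p16 (K : fieldType) (charK0 : [pchar K] =i pred0)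
    (A V : vectType K) (mul : {bilinear A -> A -> A})
    (JJA : jacobi_jordan_algebra mul)
    (rho : 'Hom(A, 'End(V))) (rhoP : representation mul rho)
    (T : 'Hom(V, A)) (TRB : relative_rota_baxter mul rho T)
    (x : A) (Nx : nijenhuis_element mul rho T x) :
  trivial_linear_deformation mul rho T (- rota_baxter_diff mul rho T x).
Proof.
have morph t := nijenhuis_morphism t JJA Nx.
split; last by exists x.
have /relative_rota_baxter_defectP T0 := TRB.
move=> t; apply/relative_rota_baxter_defectP => u v.
set J := - rota_baxter_diff _ _ _ _ in morph *.
rewrite rota_baxter_defectDZ T0 add0r.
set D1 := _ - J _; set D2 := rota_baxter_defect _ _ J u v.
(* These are the [s] and [s^2] coefficients of [(Id + s L_x)(s D1 + s^2 D2)]; the [s^3] one is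
   [mul x D2]. *)
have [D10 D20] : D1 = 0 /\ D2 + mul x D1 = 0.
  apply: (@vect_cubic_eq0 _ _ _ _ (mul x D2)) => // s.
  have := rota_baxter_morphism_defect u v (morph s).
  rewrite T0 rota_baxter_defectDZ T0 add0r -/D1 -/D2 id_add_scaleE lmulE => <-.
  clearbody D1 D2; rewrite [mul x (_ + _)]linearDr !linearZr_LR /=.
  by apply: v2r_inj; rewrite !(linearD, linearZ) /=;
     apply/rowP => i; rewrite !mxE; ring.
by move: D20; rewrite D10 linear0r addr0 => ->; rewrite !scaler0 addr0.
Qed.
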